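(* Let $A\in\mathcal{V}$ be an algebra such that $K(A)$ is closed under the commutator operation. Then the following are equivalent: (1) $A$ is an $mp$-algebra; (2) for all distinct minimal prime congruences $\phi,\psi$ of $A$ we have $\phi\vee\psi=\nabla_A$; (3) the quotient algebra $A/\rho(\Delta_A)$ is an $mp$-algebra; (4) the inclusion $Min(A)\subseteq Spec(A)$ has a continuous retraction with respect to the flat topology; (5) $Spec(A)$ is a normal space with respect to the flat topology; (6) if $\phi\in Min(A)$ then $V(\phi)$ is a flat closed subset of $Spec(A)$.
   Context: $\mathcal{V}$ is a fixed congruence-modular variety of algebras (of a finite signature) that is semidegenerate: no nontrivial algebra in $\mathcal{V}$ has one-element subalgebras (equivalently, $\nabla_A$ is compact in $Con(A)$ for every $A\in\mathcal{V}$). For $A\in\mathcal{V}$, $Con(A)$ is the complete lattice of congruences of $A$, with least element $\Delta_A$ and greatest element $\nabla_A$; $K(A)$ is the set of compact (= finitely generated) congruences. Commutator: $[\cdot,\cdot]=[\cdot,\cdot]_A$ is the (modular) commutator, i.e. the greatest operation on the congruence lattices of members of $\mathcal{V}$ such that for every surjective morphism $f:A\to B$ in $\mathcal{V}$ and all $\alpha,\beta\in Con(A)$: $[\alpha,\beta]_A\subseteq\alpha\cap\beta$ and $[\alpha,\beta]_A\vee Ker(f)=f^{-1}([f(\alpha\vee Ker(f)),f(\beta\vee Ker(f))]_B)$. $\phi\in Con(A)\setminus\{\nabla_A\}$ is prime if $[\alpha,\beta]\subseteq\phi$ implies $\alpha\subseteq\phi$ or $\beta\subseteq\phi$ (for $\alpha,\beta\in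 Con(A)$); $Spec(A)$ is the set of prime congruences, $Min(A)$ the set of minimal prime congruences; $\rho(\theta)=\bigcap\{\phi\in Spec(A)\mid\theta\subseteq\phi\}$. $A$ is an $mp$-algebra if every prime congruence of $A$ contains a unique minimal prime congruence. For $\theta\in Con(A)$, $V(\theta)=\{\phi\in Spec(A)\mid\theta\subseteq\phi\}$. The flat topology on $Spec(A)$ has as basis of open sets the family $(V(\beta))_{\beta\in K(A)}$; $Min(A)$ carries the subspace topology. ''Normal space'' means that disjoint closed sets have disjoint open neighbourhoods (no separation axiom such as $T_1$ is assumed). *)

(* Defs.v *)
From HB Require Import structures.
From mathcomp Require Import all_boot all_order generic_quotient.
From mathcomp Require Import all_classical topology separation_axioms.

Set Implicit Arguments.
Unset Strict Implicit.
Unset Printing Implicit Defensive.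

Import Order.TTheory.

Local Open Scope classical_set_scope.
Local Open Scope quotient_scope.
Local Open Scope order_scope.

Record signature := Signature {
  opsym : finType;
  arity : opsym -> nat }.

Record algebra (S : signature) := Algebra {
  carrier :> Type;
  opr : forall o : opsym S, ('I_(arity o) -> carrier) -> carrier;
  carrier_inhabited : inhabited carrier }.

Arguments opr {S} a o x.

Record hom (S : signature) (A B : algebra S) := Hom {
  hom_fun :> A -> B;
  homP : forall o (x : 'I_(arity o) -> A),
    hom_fun (opr A o x) = opr B o (hom_fun \o x) }.

Definition surj_hom (S : signature) (A B : algebra S) (f : hom A B) :=
  forall b : B, exists a : A, f a = b.

Definition prod_algebra (S : signature) (I : Type) (A : I -> algebra S) :
  algebra S.
Proof.
exists (forall i, A i) => [o x i|]; first exact: opr (A i) o (x ^~ i).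
have h i : exists x : A i, True by have [x] := carrier_inhabited (A i); exists x.
exact: inhabits (fun i => projT1 (cid (h i))).
Defined.

Definition subuniverse (S : signature) (A : algebra S) (X : set A) :=
  forall o (x : 'I_(arity o) -> A), (forall i, X (x i)) -> X (opr A o x).

(* Nonemptiness of the class is the case of the empty product. Closure under
   subalgebras is stated for embeddings, hence up to isomorphism. *)
Record variety (S : signature) := Variety {
  in_variety :> algebra S -> Prop;
  variety_H : forall (A B : algebra S) (f : hom A B),
    surj_hom f -> in_variety A -> in_variety B;
  variety_S : forall (A B : algebra S) (f : hom B A),
    injective f -> in_variety A -> in_variety B;
  variety_P : forall (I : Type) (A : I -> algebra S),
    (forall i, in_variety (A i)) -> in_variety (prod_algebra A) }.

Definition semidegenerate (S : signature) (V : variety S) :=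
  forall A : algebra S, V A ->
    (exists a : A, subuniverse [set a]) -> forall x y : A, x = y.

Record cong (S : signature) (A : algebra S) := Cong {
  cong_rel :> A -> A -> Prop;
  cong_refl : forall x, cong_rel x x;
  cong_sym : forall x y, cong_rel x y -> cong_rel y x;
  cong_trans : forall x y z, cong_rel x y -> cong_rel y z -> cong_rel x z;
  cong_opr : forall o (x y : 'I_(arity o) -> A),
    (forall i, cong_rel (x i) (y i)) -> cong_rel (opr A o x) (opr A o y) }.

Section CongruenceLattice.
Context (S : signature) (A : algebra S).
Implicit Types (a b c : cong A) (P : set (cong A)).

Lemma congP a b : (forall x y, a x y <-> b x y) -> a = b.
Proof.
case: a b => [r r1 r2 r3 r4] [s s1 s2 s3 s4] /= rs.
have E : r = s by apply/funext => x; apply/funext => y; apply/propext.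
by subst s; congr Cong; exact: Prop_irrelevance.
Qed.

Program Definition cong_bot : cong A := @Cong _ _ (fun x y => x = y) _ _ _ _.
Next Obligation. by []. Qed.
Next Obligation. by []. Qed.
Next Obligation. by move=> x y z -> ->. Qed.
Next Obligation. by move=> o x y /funext ->. Qed.

Program Definition cong_top : cong A := @Cong _ _ (fun _ _ => True) _ _ _ _.
Solve All Obligations with by [].

Program Definition cong_bigmeet P : cong A :=
  @Cong _ _ (fun x y => forall a, P a -> a x y) _ _ _ _.
Next Obligation. by move=> P x a _; exact: cong_refl. Qed.
Next Obligation. by move=> P x y xy a Pa; apply/cong_sym/xy. Qed.
Next Obligation.
by move=> P x y z xy yz a Pa; exact: cong_trans (xy a Pa) (yz a Pa).
Qed.
Next Obligation. by move=> P o x y xy a Pa; apply: cong_opr => i; exact: xy. Qed.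

Definition cong_gen (R : A -> A -> Prop) : cong A :=
  cong_bigmeet [set a : cong A | forall x y, R x y -> a x y].

Lemma cong_gen_sub (R : A -> A -> Prop) x y : R x y -> cong_gen R x y.
Proof. by move=> Rxy a; exact. Qed.

Lemma cong_gen_min (R : A -> A -> Prop) a :
  (forall x y, R x y -> a x y) -> forall x y, cong_gen R x y -> a x y.
Proof. by move=> Ra x y; exact. Qed.

Definition cong_le a b : bool := `[< forall x y, a x y -> b x y >].
Definition cong_meet a b := cong_bigmeet [set a; b].
Definition cong_join a b := cong_gen (fun x y => a x y \/ b x y).

HB.instance Definition _ := gen_eqMixin (cong A).
HB.instance Definition _ := gen_choiceMixin (cong A).
HB.instance Definition _ := isPointed.Build (cong A) cong_bot.

Fact cong_display : Order.disp_t. Proof. exact: Order.Disp tt tt. Qed.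

Fact cong_le_refl : reflexive cong_le.
Proof. by move=> a; apply/asboolP. Qed.

Fact cong_le_anti : antisymmetric cong_le.
Proof.
move=> a b /andP[/asboolP ab /asboolP ba].
by apply: congP => x y; split; [exact: ab|exact: ba].
Qed.

Fact cong_le_trans : transitive cong_le.
Proof.
by move=> b a c /asboolP ab /asboolP bc; apply/asboolP => x y /ab /bc.
Qed.

HB.instance Definition _ := Order.Le_isPOrder.Build cong_display (cong A)
  cong_le_refl cong_le_anti cong_le_trans.

Lemma cong_leP a b : reflect (forall x y, a x y -> b x y) (a <= b).
Proof. exact: asboolP. Qed.

Fact cong_meetP c a b : (c <= cong_meet a b) = (c <= a) && (c <= b).
Proof.
apply/cong_leP/andP => [h|[/cong_leP ca /cong_leP cb] x y cxy d [->|->]].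
- by split; apply/cong_leP => x y /h; apply; [left|right].
- exact: ca.
- exact: cb.
Qed.

Fact cong_joinP a b c : (cong_join a b <= c) = (a <= c) && (b <= c).
Proof.
apply/cong_leP/andP => [h|[/cong_leP ac /cong_leP bc]].
- by split; apply/cong_leP => x y xy; apply/h/cong_gen_sub; [left|right].
- by apply: cong_gen_min => x y [/ac|/bc].
Qed.

HB.instance Definition _ := Order.POrder_MeetJoin_isLattice.Build
  cong_display (cong A) cong_meetP cong_joinP.

Fact cong_bot_le a : cong_bot <= a.
Proof. by apply/cong_leP => x y ->; exact: cong_refl. Qed.

Fact cong_le_top a : a <= cong_top.
Proof. exact/cong_leP. Qed.

HB.instance Definition _ :=
  Order.hasBottom.Build cong_display (cong A) cong_bot_le.
HB.instance Definition _ :=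
  Order.hasTop.Build cong_display (cong A) cong_le_top.

(* Finitely generated, that is, compact. *)
Definition fingen a : Prop :=
  exists2 R : set (A * A), finite_set R & a = cong_gen (fun x y => R (x, y)).

Lemma fingen_bot : fingen \bot.
Proof.
exists set0 => //; apply/le_anti/andP; split; first exact: le0x.
by apply/cong_leP; apply: cong_gen_min.
Qed.

Lemma fingenU a b : fingen a -> fingen b -> fingen (a `|` b)%O.
Proof.
move=> [R Rfin ->] [T Tfin ->]; exists (R `|` T)%classic.
  by rewrite finite_setU.
apply/le_anti/andP; split.
  by rewrite leUx; apply/andP; split; apply/cong_leP; apply: cong_gen_min => x y h;
    apply: cong_gen_sub; [left|right].
apply/cong_leP; apply: cong_gen_min => x y [h|h].
- by apply: (elimT (cong_leP _ _) (leUl _ _)); exact: cong_gen_sub.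
- by apply: (elimT (cong_leP _ _) (leUr _ _)); exact: cong_gen_sub.
Qed.

End CongruenceLattice.

Definition congruence_modular (S : signature) (V : variety S) :=
  forall A : algebra S, V A -> forall a b c : cong A,
    a <= c -> (a `|` (b `&` c) = (a `|` b) `&` c)%O.

Program Definition cong_preim (S : signature) (A B : algebra S) (f : hom A B)
  (b : cong B) : cong A := @Cong _ _ (fun x y => b (f x) (f y)) _ _ _ _.
Next Obligation. by move=> S A B f b x; exact: cong_refl. Qed.
Next Obligation. by move=> S A B f b x y; exact: cong_sym. Qed.
Next Obligation. by move=> S A B f b x y z; exact: cong_trans. Qed.
Next Obligation.
by move=> S A B f b o x y xy /=; rewrite !homP; exact: cong_opr.
Qed.

Definition Ker (S : signature) (A B : algebra S) (f : hom A B) : cong A :=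
  cong_preim f \bot.

Definition rel_im (S : signature) (A B : algebra S) (f : hom A B) (a : cong A)
  (u v : B) : Prop := exists x y, [/\ a x y, f x = u & f y = v].

(* The image relation need not be a congruence in general; it is one in the case
   of interest, where f is onto and its kernel is below a: see cong_imE. *)
Definition cong_im (S : signature) (A B : algebra S) (f : hom A B)
  (a : cong A) : cong B := cong_gen (rel_im f a).

Lemma cong_imE (S : signature) (A B : algebra S) (f : hom A B) (a : cong A) :
  surj_hom f -> Ker f <= a -> cong_im f a = rel_im f a :> (B -> B -> Prop).
Proof.
move=> fsurj /cong_leP kera.
have lift x y u v : f x = u -> f y = v -> rel_im f a u v -> a x y.
  move=> fx fy [x' [y' [xy' fx' fy']]].
  apply: (cong_trans (y := x')); first by apply: kera; rewrite /= fx fx'.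
  by apply: (cong_trans xy'); apply: kera; rewrite /= fy fy'.
have @c : cong B.
  exists (rel_im f a).
  - by move=> u; have [x <-] := fsurj u; exists x, x; split=> //; exact: cong_refl.
  - by move=> u v [x [y [xy <- <-]]]; exists y, x; split=> //; exact: cong_sym.
  - move=> u v w [x [y [xy <- <-]]] [y' [z [yz fy <-]]].
    exists x, z; split=> //; apply: (cong_trans xy).
    apply: (cong_trans _ yz); apply: kera; exact/esym.
  - move=> o u v uv.
    have [g gE] := choice fsurj.
    exists (opr A o (g \o u)), (opr A o (g \o v)).
    split; last 2 first.
    + by rewrite homP; congr opr; apply/funext => i /=.
    + by rewrite homP; congr opr; apply/funext => i /=.
    by apply: cong_opr => i /=; apply: lift (uv i); exact: gE.
apply/funext => u; apply/funext => v; apply/propext; split.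
  by move=> /(_ c); apply.
exact: cong_gen_sub.
Qed.

Definition cong_binop (S : signature) :=
  forall A : algebra S, cong A -> cong A -> cong A.

Definition commutator_like (S : signature) (V : variety S) (C : cong_binop S) :=
  forall (A B : algebra S) (f : hom A B), V A -> V B -> surj_hom f ->
  forall a b : cong A,
    C A a b <= (a `&` b)%O /\
    (C A a b `|` Ker f)%O =
      cong_preim f (C B (cong_im f (a `|` Ker f)%O) (cong_im f (b `|` Ker f)%O)).

(* In a congruence-modular variety there is a greatest such operation; this
   determines C on the members of V, and its values elsewhere are irrelevant. *)
Definition is_commutator (S : signature) (V : variety S) (C : cong_binop S) :=
  commutator_like V C /\
  forall D : cong_binop S, commutator_like V D ->
    forall A : algebra S, V A -> forall a b : cong A, D A a b <= C A a b.

Section Spectrum.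
Context (S : signature) (C : cong_binop S) (A : algebra S).

Definition prime_cong (p : cong A) : Prop :=
  p != \top /\ forall a b : cong A, C a b <= p -> a <= p \/ b <= p.

Record spec := Spec { spec_cong :> cong A; spec_prime : prime_cong spec_cong }.

HB.instance Definition _ := gen_eqMixin spec.
HB.instance Definition _ := gen_choiceMixin spec.

Definition rho (a : cong A) : cong A :=
  cong_bigmeet [set p : cong A | prime_cong p /\ a <= p].

Definition minspec : set spec :=
  [set p : spec | forall q : spec, (q : cong A) <= p -> q = p].

Definition mp_algebra : Prop :=
  forall p : spec, exists! q : spec, minspec q /\ (q : cong A) <= p.

Definition specV (a : cong A) : set spec := [set p : spec | a <= p].

Fact flat_cover : \bigcup_(b in @fingen S A) specV b = setT.
Proof.
apply/seteqP; split=> // p _; exists \bot; first exact: fingen_bot.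
exact: le0x.
Qed.

Fact flat_join (a b : cong A) (p : spec) : fingen a -> fingen b ->
  specV a p -> specV b p ->
  exists c, [/\ fingen c, specV c p & specV c `<=` specV a `&` specV b].
Proof.
move=> fa fb ap bp; exists (a `|` b)%O; split; first exact: fingenU.
  by rewrite /specV /= leUx; apply/andP.
by move=> q; rewrite /specV /= leUx => /andP.
Qed.

(* The flat topology: unlike in the Zariski topology, the sets specV b with b
   finitely generated are basic open sets. *)
HB.instance Definition _ :=
  @isBaseTopological.Build spec (cong A) (@fingen S A) specV flat_cover flat_join.

(* minspec, seen as a type, carries the subspace topology (set_type). *)
Definition has_minspec_retraction : Prop :=
  exists2 r : spec -> minspec, continuous r & forall m : minspec, r (set_val m) = m.

End Spectrum.

Arguments specV {S} C {A} a.

Section Quotient.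
Context (S : signature) (A : algebra S) (a : cong A).

Definition quot_rel : rel {classic A} := fun x y => `[< a x y >].

Fact quot_rel_equiv : equiv_class_of quot_rel.
Proof.
split=> [x|x y|y x z].
- by apply/asboolP; exact: cong_refl.
- by apply/asboolP/asboolP; exact: cong_sym.
- by move=> /asboolP xy /asboolP yz; apply/asboolP; exact: cong_trans xy yz.
Qed.

Canonical quot_equiv := EquivRelPack quot_rel_equiv.

Definition quot_opr o (x : 'I_(arity o) -> {eq_quot quot_equiv}) :
    {eq_quot quot_equiv} :=
  \pi_{eq_quot quot_equiv} (opr A o (fun i => repr (x i))).

Fact quot_inhabited : inhabited {eq_quot quot_equiv}.
Proof.
by have [x] := carrier_inhabited A; exact: inhabits (\pi_{eq_quot quot_equiv} x).
Qed.

Definition quot_algebra : algebra S := Algebra quot_opr quot_inhabited.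

Definition quot_pi (x : A) : quot_algebra := \pi_{eq_quot quot_equiv} x.

Lemma quot_piE x y : quot_pi x = quot_pi y <-> a x y.
Proof. by split=> [/eqquotP/asboolP//|xy]; apply/eqquotP/asboolP. Qed.

Lemma quot_pi_surj (u : quot_algebra) : exists x, quot_pi x = u.
Proof. by exists (repr u); exact: reprK. Qed.

Fact quot_pi_hom o (x : 'I_(arity o) -> A) :
  quot_pi (opr A o x) = opr quot_algebra o (quot_pi \o x).
Proof.
apply/quot_piE; apply: cong_opr => i; apply/quot_piE.
by rewrite /quot_pi /= reprK.
Qed.

Definition quot_hom : hom A quot_algebra := Hom quot_pi_hom.

End Quotient.

(* Main.v *)
Require Import Defs.
From mathcomp Require Import all_boot all_order.
From mathcomp Require Import all_classical topology separation_axioms.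

(** The six conditions express, in different ways, that distinct minimal primes
    are separated from each other. Besides the closure of K(A) under the
    commutator, the argument needs four facts about A: the commutator is
    monotone, [a \/ d, b \/ d] lies below [a, b] \/ d, [1, 1] = 1, and the top
    congruence 1 is finitely generated.

    Given these, Krull's argument (prime_above_avoiding) yields a prime above any
    proper congruence, so two primes either join to 1 or lie below a common
    prime; this is the equivalence of the first two conditions. It also yields
    the finite intersection property prime_avoiding, from which the spectrum is
    flat-compact (flat_compact). If every prime p contains just one minimal prime
    r(p), then p and any n with r(n) <> r(p) are comaximal, hence separated by
    finitely generated congruences x <= p and y <= n with x \/ y = 1. By the
    finite intersection property finitely many such y suffice at a time, so r is
    continuous (mp_retraction). The minimal spectrum is then Hausdorff and, as an
    image of the spectrum, compact, hence normal with closed points; pulling back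
    along r gives the normality of the spectrum and the closedness of V(m) for m
    minimal. Conversely flat-open sets are closed upwards and the flat closure of
    p consists of the primes below p, so each topological condition forbids two
    minimal primes below the same prime. Passing to the quotient by the
    intersection of all primes does not change the ordered set of primes.

    The four facts have to be extracted from the definition of the commutator.
    Monotonicity is formal: the monotone hull of the commutator still satisfies
    the two defining conditions, by the modular law (monotone_hullP). The
    inequality for joins is the second defining condition for A -> A/d. The top
    congruence is generated by the finitely many pairs (x, o(x, .., x)), because
    the quotient by them has an idempotent element. For [1, 1] = 1, the
    term-condition commutator is shown to satisfy the defining conditions
    (term_commutatorP), so it lies below the given one. It has value 1 at (1, 1)
    because the diagonal of A x A collapses to an idempotent element of the
    quotient by Delta_(1,1), which must therefore be trivial. That the term
    condition behaves well rests on the shifting lemma, the geometric form of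
    modularity, applied to the congruence lattice of a congruence b regarded as a
    subalgebra of A x A. *)

Set Implicit Arguments.
Unset Strict Implicit.
Unset Printing Implicit Defensive.

Import Order.TTheory.

Local Open Scope classical_set_scope.
Local Open Scope order_scope.

(** * Congruence lattices *)

Section CongruenceFacts.
Context (S : signature) (A : algebra S).
Implicit Types (a b c : cong A) (R : A -> A -> Prop).

Lemma cong_le_rel a b x y : a <= b -> a x y -> b x y.
Proof. by move=> /cong_leP; exact. Qed.

Lemma cong_gen_le R a : (forall x y, R x y -> a x y) -> cong_gen R <= a.
Proof. by move=> h; apply/cong_leP; exact: cong_gen_min. Qed.

Lemma cong_bigmeet_le (P : set (cong A)) a : P a -> cong_bigmeet P <= a.
Proof. by move=> Pa; apply/cong_leP => x y; exact. Qed.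

Lemma cong_meet_rel a b x y : a x y -> b x y -> (a `&` b)%O x y.
Proof.
move=> axy bxy; apply: (cong_le_rel (a := cong_meet a b)); last first.
  by move=> d [->|->].
by rewrite lexI !cong_bigmeet_le//; [right|left].
Qed.

Lemma le_cong_bigmeet (P : set (cong A)) a :
  (forall b, P b -> a <= b) -> a <= cong_bigmeet P.
Proof.
by move=> h; apply/cong_leP => x y axy b Pb; exact: cong_le_rel (h b Pb) axy.
Qed.

Fixpoint chain R n x y : Prop :=
  if n is n'.+1 then exists2 z, R x z & chain R n' z y else x = y.

Lemma chain_cat R m n x y z : chain R m x y -> chain R n y z ->
  chain R (m + n)%N x z.
Proof.
elim: m x => [x -> //|m IH x [w Rxw wy] yz].
by exists w => //; exact: IH.
Qed.

Lemma chain_sym R n x y : (forall u v, R u v -> R v u) ->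
  chain R n x y -> chain R n y x.
Proof.
move=> Rs; elim: n x => [x -> //|n IH x [w Rxw /IH wy]].
by rewrite -addn1; apply: chain_cat wy _; exists x => //; exact: Rs.
Qed.

Lemma chain_widen R m n x y : (forall u, R u u) -> (m <= n)%N ->
  chain R m x y -> chain R n x y.
Proof.
move=> Rr /subnK <-; elim: (n - m)%N => [//|k IH] /IH h.
by rewrite addSn; exists x.
Qed.

Lemma chain_opr R n o (x y : 'I_(arity o) -> A) :
  (forall o (x y : 'I_(arity o) -> A), (forall i, R (x i) (y i)) ->
    R (opr A o x) (opr A o y)) ->
  (forall i, chain R n (x i) (y i)) -> chain R n (opr A o x) (opr A o y).
Proof.
move=> Rc; elim: n x => [x h|n IH x h].
  by congr opr; apply/funext.
have /choice[z zE] : forall i, exists z, R (x i) z /\ chain R n z (y i).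
  by move=> i; have [z ? ?] := h i; exists z.
exists (opr A o z); first by apply: Rc => i; have [] := zE i.
by apply: IH => i; have [] := zE i.
Qed.

(** The congruence generated by a tolerance is its transitive closure: arities are
    finite, so the chains that join the arguments of an operation can be brought
    to a common length. *)
Lemma cong_gen_saturated R (X : set A) :
  (forall x, R x x) -> (forall x y, R x y -> R y x) ->
  (forall o (x y : 'I_(arity o) -> A), (forall i, R (x i) (y i)) ->
    R (opr A o x) (opr A o y)) ->
  (forall x y, R x y -> X x -> X y) ->
  forall x y, cong_gen R x y -> X x -> X y.
Proof.
move=> Rr Rs Rc RX x y.
suff h : cong_gen R x y -> exists n, chain R n x y.
  move=> /h[n]; elim: n x {h} => [x -> //|n IH x [z Rxz /IH zy] /(RX _ _ Rxz)].
  exact: zy.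
have @t : cong A.
  exists (fun x y => exists n, chain R n x y).
  - by move=> u; exists 0.
  - by move=> u v [n uv]; exists n; exact: chain_sym.
  - by move=> u v w [m uv] [n vw]; exists (m + n)%N; exact: chain_cat uv vw.
  - move=> o u v /choice[n nE]; exists (\max_i n i).
    apply: chain_opr => // i; apply: chain_widen (nE i) => //.
    exact: leq_bigmax.
apply: (@cong_gen_min _ _ R t) => u v Ruv.
by exists 1, v.
Qed.

Definition saturated a (X : set A) := forall x y, a x y -> X x -> X y.

Lemma saturated_join a b X :
  saturated a X -> saturated b X -> saturated (a `|` b)%O X.
Proof.
move=> aX bX x y xy.
(* a o b o a is a tolerance that contains both a and b *)
pose R u v := exists p q, [/\ a u p, b p q & a q v].
apply: (cong_gen_saturated (R := R)).
- by move=> u; exists u, u; split; exact: cong_refl.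
- by move=> u v [p [q [? ? ?]]]; exists q, p; split; exact: cong_sym.
- move=> o u v /choice[p /choice[q h]].
  by exists (opr A o p), (opr A o q);
    split; apply: cong_opr => i; have [] := h i.
- by move=> u v [p [q [up pq qv]]] /(aX _ _ up)/(bX _ _ pq)/(aX _ _ qv).
- apply: cong_le_rel xy; rewrite leUx; apply/andP.
  split; apply/cong_leP => u v uv; apply: cong_gen_sub.
    by exists v, v; split=> //; exact: cong_refl.
  by exists u, v; split=> //; exact: cong_refl.
Qed.

End CongruenceFacts.

Section Surjections.
Context (S : signature) (A B : algebra S) (f : hom A B).

Lemma preimP (b : cong B) x y : cong_preim f b x y <-> b (f x) (f y).
Proof. by []. Qed.

Lemma KerP x y : Ker f x y <-> f x = f y.
Proof. by []. Qed.

Lemma le_preim (b b' : cong B) : b <= b' -> cong_preim f b <= cong_preim f b'.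
Proof. by move=> /cong_leP bb; apply/cong_leP => x y /=; exact: bb. Qed.

Lemma Ker_le_preim (b : cong B) : Ker f <= cong_preim f b.
Proof. exact/le_preim/le0x. Qed.

Lemma cong_im_le (a a' : cong A) : a <= a' -> cong_im f a <= cong_im f a'.
Proof.
move=> /cong_leP aa'; apply: cong_gen_le => _ _ [x [y [/aa' xy <- <-]]].
by apply: cong_gen_sub; exists x, y.
Qed.

Lemma cong_im_sub (a : cong A) x y : a x y -> cong_im f a (f x) (f y).
Proof. by move=> axy; apply: cong_gen_sub; exists x, y. Qed.

Context (fsurj : surj_hom f).

Lemma preim_le (b b' : cong B) : cong_preim f b <= cong_preim f b' -> b <= b'.
Proof.
move=> /cong_leP h; apply/cong_leP => u v.
by have [[x <-] [y <-]] := (fsurj u, fsurj v); exact: h.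
Qed.

Lemma preim_inj : injective (cong_preim f).
Proof. by move=> b b' h; apply/le_anti/andP; split; apply: preim_le; rewrite h. Qed.

Lemma imK (a : cong A) : Ker f <= a -> cong_preim f (cong_im f a) = a.
Proof.
move=> kera; apply/le_anti/andP; split; apply/cong_leP => x y; last first.
  exact: cong_im_sub.
move=> h; have : rel_im f a (f x) (f y) by rewrite -cong_imE.
move=> [x' [y' [xy fx fy]]].
apply: (cong_trans (y := x')); first by apply: (cong_le_rel kera); apply/KerP.
by apply: (cong_trans xy); apply: (cong_le_rel kera); apply/KerP.
Qed.

Lemma preimK (b : cong B) : cong_im f (cong_preim f b) = b.
Proof. by apply: preim_inj; rewrite imK// Ker_le_preim. Qed.

Lemma preim_top : cong_preim f \top = \top.
Proof. by apply/le_anti/andP; split; [exact: lex1|apply/cong_leP]. Qed.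

End Surjections.

(** * The term condition *)

Section CongruenceAsAlgebra.
Context (S : signature) (A : algebra S).
Implicit Types a b d : cong A.

Record pair_in b := PairIn { lft : A; rgt : A; lft_rgt : b lft rgt }.

Lemma pair_in_eq b (p q : pair_in b) : lft p = lft q -> rgt p = rgt q -> p = q.
Proof.
case: p q => [x y h] [x' y' h'] /= ex ey; subst x' y'.
by congr PairIn; exact: Prop_irrelevance.
Qed.

Definition pair_opr b o (x : 'I_(arity o) -> pair_in b) : pair_in b :=
  PairIn (cong_opr (fun i => lft_rgt (x i))).

Lemma pair_in_inhabited b : inhabited (pair_in b).
Proof.
have [x] := carrier_inhabited A; exact: inhabits (PairIn (cong_refl b x)).
Qed.

Definition pair_alg b : algebra S := Algebra (@pair_opr b) (pair_in_inhabited b).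

Definition lft_hom b : hom (pair_alg b) A :=
  @Hom _ (pair_alg b) A (@lft b) (fun _ _ => erefl).

Definition rgt_hom b : hom (pair_alg b) A :=
  @Hom _ (pair_alg b) A (@rgt b) (fun _ _ => erefl).

Definition diag b (x : A) : pair_alg b := PairIn (cong_refl b x).

Lemma diag_opr b o (x : 'I_(arity o) -> A) :
  diag b (opr A o x) = opr (pair_alg b) o (diag b \o x).
Proof. exact: pair_in_eq. Qed.

Definition diag_hom b : hom A (pair_alg b) := Hom (@diag_opr b).

Definition pairs_into_square b (p : pair_alg b) :
  prod_algebra (fun _ : bool => A) := fun i => if i then lft p else rgt p.

Lemma pairs_into_squareM b o (x : 'I_(arity o) -> pair_alg b) :
  pairs_into_square (opr (pair_alg b) o x) =
  opr (prod_algebra (fun _ : bool => A)) o (@pairs_into_square b \o x).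
Proof. by apply: functional_extensionality_dep; case. Qed.

Lemma variety_pair_alg (V : variety S) b : V A -> V (pair_alg b).
Proof.
move=> VA.
apply: (@variety_S _ V _ _ (Hom (@pairs_into_squareM b))) => /=.
  move=> p q e; apply: pair_in_eq.
    exact: (congr1 (fun g => g true) e).
  exact: (congr1 (fun g => g false) e).
exact: variety_P.
Qed.

(** The congruence written Delta_(b,a) in commutator theory. *)
Definition Delta b a : cong (pair_alg b) :=
  cong_gen (fun p q => exists x y, [/\ a x y, p = diag b x & q = diag b y]).

Lemma Delta_diag b a x y : a x y -> Delta b a (diag b x) (diag b y).
Proof. by move=> axy; apply: cong_gen_sub; exists x, y. Qed.

Lemma Delta_le b a (g : cong (pair_alg b)) :
  (forall x y, a x y -> g (diag b x) (diag b y)) -> Delta b a <= g.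
Proof. by move=> h; apply: cong_gen_le => _ _ [x [y [axy -> ->]]]; exact: h. Qed.

Lemma Delta_lft b a (p q : pair_alg b) : Delta b a p q -> a (lft p) (lft q).
Proof. by apply: (cong_le_rel (b := cong_preim (lft_hom b) a)); exact: Delta_le. Qed.

Lemma Delta_rgt b a (p q : pair_alg b) : Delta b a p q -> a (rgt p) (rgt q).
Proof. by apply: (cong_le_rel (b := cong_preim (rgt_hom b) a)); exact: Delta_le. Qed.

(** The term condition, that a centralizes b modulo d, phrased without terms: the
    2 x 2 matrices of the term condition are the pairs of rows in the subalgebra
    that generates Delta b a, and saturation passes to its transitive closure. *)
Definition central a b d :=
  saturated (Delta b a) [set p : pair_alg b | d (lft p) (rgt p)].

Definition pair_swap b (p : pair_alg b) : pair_alg b :=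
  @PairIn b (rgt p) (lft p) (cong_sym (lft_rgt p)).

Lemma pair_swapM b o (x : 'I_(arity o) -> pair_alg b) :
  pair_swap (opr (pair_alg b) o x) = opr (pair_alg b) o (@pair_swap b \o x).
Proof. exact: pair_in_eq. Qed.

Definition swap_hom b : hom (pair_alg b) (pair_alg b) := Hom (@pair_swapM b).

Lemma Delta_swap b a (p q : pair_alg b) :
  Delta b a p q -> Delta b a (swap_hom b p) (swap_hom b q).
Proof.
apply: (cong_le_rel (b := cong_preim (swap_hom b) (Delta b a))).
apply: Delta_le => x y axy; apply/preimP.
have e z : swap_hom b (diag b z) = diag b z by exact: pair_in_eq.
by rewrite !e; exact: Delta_diag.
Qed.

Lemma central_bigmeet a b (P : set (cong A)) :
  (forall d, P d -> central a b d) -> central a b (cong_bigmeet P).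
Proof. by move=> h p q pq dp d Pd; apply: h Pd _ _ pq (dp d Pd). Qed.

Lemma central_le a b d : a <= d -> central a b d.
Proof.
move=> ad p q pq /= dp; apply: cong_trans (cong_le_rel ad (Delta_rgt pq)).
by apply: cong_trans dp; apply/cong_sym/(cong_le_rel ad (Delta_lft pq)).
Qed.

Lemma central_right a b : central a b b.
Proof. by move=> p q _ _ /=; exact: lft_rgt. Qed.

(** The congruence Delta b (a `|` a') is the join of Delta b a and Delta b a',
    because the pairs (x, y) for which a congruence relates the diagonal elements
    at x and y form a congruence of A. *)
Lemma central_joinl a a' b d :
  central a b d -> central a' b d -> central (a `|` a')%O b d.
Proof.
move=> ca ca' p q pq; apply: (saturated_join ca ca').
apply: cong_le_rel pq; apply: Delta_le => x y.
apply: (cong_le_rel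
  (b := cong_preim (diag_hom b) (Delta b a `|` Delta b a')%O)).
rewrite leUx; apply/andP; split; apply/cong_leP => u v uv;
  apply/preimP.
  by apply: (cong_le_rel (leUl _ _)); exact: Delta_diag.
by apply: (cong_le_rel (leUr _ _)); exact: Delta_diag.
Qed.

End CongruenceAsAlgebra.

Section TermConditionModular.
Context (S : signature) (V : variety S) (Vmod : congruence_modular V).

(** The shifting lemma of Gumm: in a parallelogram with two sides in a and two in
    b, membership in c moves from the side (z, u) to the opposite side (x, y). By
    modularity, a meets (a `&` c) `|` b in (a `&` c) `|` (a `&` b). *)
Lemma shifting (A : algebra S) (VA : V A) (a b c : cong A) x y z u :
  (a `&` b)%O <= c -> a x y -> a z u -> b x z -> b y u -> c z u -> c x y.
Proof.
move=> abc axy azu bxz byu czu.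
have := Vmod VA b (leIl a c).
rewrite [(b `&` a)%O]meetC => e.
apply: (cong_le_rel (a := ((a `&` c) `|` (a `&` b))%O)).
  by rewrite leUx leIr.
rewrite e; apply: cong_meet_rel => //.
apply: (cong_trans (y := z)); first exact: cong_le_rel (leUr _ _) bxz.
apply: (cong_trans (y := u)); last exact/cong_sym/(cong_le_rel (leUr _ _) byu).
by apply: (cong_le_rel (leUl _ _)); exact: cong_meet_rel.
Qed.

Context (A : algebra S) (VA : V A).
Implicit Types a b d : cong A.

(** Reformulation that is visibly upward closed in d. Given rows (x, y) and (x, z)
    related by Delta, shifting along the second projection replaces them by
    (y, y) and (y, z), and the first of these lies in d. *)
Lemma central_meet a b d : central a b d ->
  (Delta b a `&` Ker (lft_hom b))%O <= cong_preim (rgt_hom b) d.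
Proof.
move=> cd; apply/cong_leP => p q pq /=.
have kpq : lft p = lft q by exact: cong_le_rel (leIr _ _) pq.
have lq : b (rgt p) (rgt q).
  apply: cong_trans (lft_rgt q); rewrite -kpq; exact/cong_sym/lft_rgt.
pose q' : pair_alg b := PairIn lq.
suff : Delta b a (diag b (rgt p)) q' by move=> /cd; apply; exact: cong_refl.
apply: (shifting (variety_pair_alg b VA) (a := Ker (lft_hom b))
  (b := Ker (rgt_hom b)) (z := p) (u := q)) => //.
- apply/cong_leP => s t st.
  have -> : s = t; last exact: cong_refl.
  apply: pair_in_eq.
    by apply/(KerP (lft_hom b)); exact: cong_le_rel (leIl _ _) st.
  by apply/(KerP (rgt_hom b)); exact: cong_le_rel (leIr _ _) st.
- exact: cong_le_rel (leIl _ _) pq.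
Qed.

(** A row (x, y) and its diagonal row (x, x) agree in the first projection, so two
    rows related by Delta span, with their diagonal rows, a parallelogram whose
    other sides lie in Delta. By central_meet, membership in d' can be shifted
    across it. *)
Lemma central_up a b d d' : d <= d' -> central a b d -> central a b d'.
Proof.
move=> dd' /central_meet cd p q pq /= dp.
have cd' : (Ker (lft_hom b) `&` Delta b a)%O <= cong_preim (rgt_hom b) d'.
  by rewrite meetC; apply: le_trans cd (le_preim _ dd').
apply/cong_sym.
apply: (shifting (variety_pair_alg b VA) (x := q) (y := diag b (lft q))
  (z := p) (u := diag b (lft p)) cd') => //.
- exact: cong_sym.
- exact/cong_sym/Delta_diag/(Delta_lft pq).
- exact: cong_sym.
Qed.

(** The same parallelogram as in central_up, shifted in the other direction: it
    exchanges the roles of rows and columns. *)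
Lemma central_transfer a b d (u v : pair_alg b) : central a b d ->
  Delta b a u v -> d (lft u) (lft v) -> d (rgt u) (rgt v).
Proof.
move=> /central_meet cd uv duv.
apply: (shifting (variety_pair_alg b VA) (x := u) (y := v)
  (z := diag b (lft u)) (u := diag b (lft v)) cd) => //.
exact/Delta_diag/(Delta_lft uv).
Qed.

Lemma central_sym a b d : central a b d -> central b a d.
Proof.
move=> cd p q.
(* p and q are the columns of the matrix with rows u and v *)
pose R (p q : pair_alg a) := exists u v : pair_alg b,
  Delta b a u v /\ [/\ lft u = lft p, lft v = rgt p,
                       rgt u = lft q & rgt v = rgt q].
move=> pq; apply: (cong_gen_saturated (R := R)).
- move=> s; exists (diag b (lft s)), (diag b (rgt s)); split=> //.
  exact/Delta_diag/lft_rgt.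
- move=> s t [u [v [uv [e1 e2 e3 e4]]]].
  exists (swap_hom b u), (swap_hom b v); split; last by split.
  exact: Delta_swap.
- move=> o s t /choice[u /choice[v h]].
  exists (opr (pair_alg b) o u), (opr (pair_alg b) o v); split.
    by apply: cong_opr => i; have [] := h i.
  by split; congr (opr A o _); apply/funext => i;
    have [_ []] := h i.
- move=> s t [u [v [uv [e1 e2 e3 e4]]]] /=.
  by rewrite -e1 -e2 -e3 -e4; exact: central_transfer cd uv.
- apply: cong_le_rel pq; apply: cong_gen_le => _ _ [x [y [bxy -> ->]]].
  apply: cong_gen_sub; exists (PairIn bxy), (PairIn bxy).
  by split; first exact: cong_refl.
Qed.

Lemma central_join_below a b d k :
  k <= d -> central a b d -> central (a `|` k)%O (b `|` k)%O d.
Proof.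
move=> kd cd.
have {}cd : central (a `|` k)%O b d.
  by apply: central_joinl => //; exact: central_le.
apply/central_sym/central_joinl; first exact: central_sym.
exact: central_le.
Qed.

End TermConditionModular.

Section CentralSurjection.
Context (S : signature) (A B : algebra S) (f : hom A B).

Section PairMap.
Context (a b : cong A) (b' : cong B) (bb' : b <= cong_preim f b').

Definition pair_map (p : pair_alg b) : pair_alg b' :=
  @PairIn _ _ b' (f (lft p)) (f (rgt p)) (cong_le_rel bb' (lft_rgt p)).

Lemma pair_mapM o (x : 'I_(arity o) -> pair_alg b) :
  pair_map (opr (pair_alg b) o x) = opr (pair_alg b') o (pair_map \o x).
Proof. by apply: pair_in_eq => /=; rewrite homP. Qed.

Definition pair_map_hom : hom (pair_alg b) (pair_alg b') := Hom pair_mapM.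

Lemma Delta_pair_map (a' : cong B) : a <= cong_preim f a' ->
  Delta b a <= cong_preim pair_map_hom (Delta b' a').
Proof.
move=> aa'; apply: Delta_le => x y axy; apply/preimP.
have e z : pair_map_hom (diag b z) = diag b' (f z) by exact: pair_in_eq.
by rewrite !e; apply: Delta_diag; exact: cong_le_rel aa' axy.
Qed.

End PairMap.

Lemma central_preim (a b : cong A) (a' b' d : cong B) :
  a <= cong_preim f a' -> b <= cong_preim f b' ->
  central a' b' d -> central a b (cong_preim f d).
Proof.
move=> aa' bb' cd p q pq.
have /preimP : cong_preim (pair_map_hom bb') (Delta b' a') p q.
  exact: cong_le_rel (Delta_pair_map bb' aa') pq.
by move=> /cd; exact.
Qed.

(** Rows over B related by Delta lift to rows over A that are related by the join
    of Delta with the kernel of the map of rows, and the preimage of d is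
    saturated under both. *)
Lemma central_surj (a b d : cong B) : surj_hom f ->
  central (cong_preim f a) (cong_preim f b) (cong_preim f d) -> central a b d.
Proof.
move=> fsurj cd p q pq dp.
pose F := pair_map_hom (lexx (cong_preim f b)).
have Fsurj : surj_hom F.
  move=> [x y h]; have [[x' ex] [y' ey]] := (fsurj x, fsurj y).
  have h' : cong_preim f b x' y' by apply/preimP; rewrite ex ey.
  by exists (PairIn h'); exact: pair_in_eq.
pose D := (Delta (cong_preim f b) (cong_preim f a) `|` Ker F)%O.
have DD : Delta b a <= cong_im F D.
  apply: Delta_le => x y.
  have [[x' <-] [y' <-]] := (fsurj x, fsurj y) => axy.
  have e z : diag b (f z) = F (diag _ z) by exact: pair_in_eq.
  rewrite !e; apply: cong_im_sub; apply: (cong_le_rel (leUl _ _)).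
  exact: Delta_diag.
have : rel_im F D p q by rewrite -cong_imE ?leUr //; exact: cong_le_rel DD pq.
move=> [p' [q' [pq' ep eq]]].
suff /(_ p' q' pq') : saturated D [set p | cong_preim f d (lft p) (rgt p)].
  by rewrite /= -eq; apply; move: dp; rewrite -ep.
apply: saturated_join => // u v /KerP uv /= du.
have : d (lft (F u)) (rgt (F u)) by [].
by rewrite uv.
Qed.

End CentralSurjection.

(** * Lower bounds for the commutator *)

Section Commutator.
Context (S : signature) (V : variety S) (Vmod : congruence_modular V).

Definition term_commutator : cong_binop S :=
  fun A a b => cong_bigmeet [set d | central a b d].

Lemma term_commutator_central (A : algebra S) (a b : cong A) :
  central a b (term_commutator a b).
Proof. exact: central_bigmeet. Qed.

Lemma term_commutator_le (A : algebra S) (a b d : cong A) :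
  central a b d -> term_commutator a b <= d.
Proof. exact: cong_bigmeet_le. Qed.

(** In the nontrivial inclusion, the congruence e = [a, b] `|` Ker f is one modulo
    which a centralizes b, by upward closure; then both arguments may be enlarged
    by Ker f <= e, and the term condition descends along f. *)
Lemma term_commutatorP : commutator_like V term_commutator.
Proof.
move=> A B f VA VB fsurj a b; split.
  rewrite lexI !term_commutator_le//; [exact: central_right|exact: central_le].
set a' := (a `|` Ker f)%O; set b' := (b `|` Ker f)%O.
have ea : cong_preim f (cong_im f a') = a' by rewrite imK// leUr.
have eb : cong_preim f (cong_im f b') = b' by rewrite imK// leUr.
apply/le_anti/andP; split.
  rewrite leUx Ker_le_preim andbT; apply: term_commutator_le.
  apply: (central_preim (a' := cong_im f a') (b' := cong_im f b')).
  - by rewrite ea leUl.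
  - by rewrite eb leUl.
  - exact: term_commutator_central.
set e := (_ `|` Ker f)%O.
have ee : cong_preim f (cong_im f e) = e by rewrite imK// leUr.
rewrite -[X in _ <= X]ee; apply: le_preim.
apply: term_commutator_le; apply: (central_surj fsurj); rewrite ea eb ee.
apply: (central_join_below Vmod) => //; first exact: leUr.
by apply: (central_up Vmod VA (leUl _ _)); exact: term_commutator_central.
Qed.

(** All diagonal pairs of A x A are congruent modulo Delta, so their class is an
    idempotent element of the quotient. The quotient is therefore trivial, and
    every pair is congruent to a diagonal one. *)
Lemma semidegenerate_term_commutator (A : algebra S) :
  semidegenerate V -> V A -> term_commutator (\top : cong A) \top = \top.
Proof.
move=> Vsemi VA; apply/le_anti; rewrite lex1 /=; apply/cong_leP => x y _.
set d := term_commutator _ _.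
pose D := Delta (\top : cong A) \top.
have tt u v : (\top : cong A) u v by [].
suff h : D (diag _ x) (PairIn (tt x y)).
  by apply: (term_commutator_central h); exact: cong_refl.
apply/quot_piE; apply: Vsemi.
  apply: (variety_H (f := quot_hom D)); last exact: variety_pair_alg.
  exact: quot_pi_surj.
exists (quot_pi D (diag _ x)) => o u uE.
have -> : u = quot_pi D \o (fun _ => diag _ x) by apply/funext.
rewrite -quot_pi_hom; apply/quot_piE; rewrite -diag_opr.
exact: Delta_diag.
Qed.

End Commutator.

(** * The commutator of a semidegenerate congruence-modular variety *)

Section CommutatorFacts.
Context (S : signature) (V : variety S) (Vmod : congruence_modular V).
Context (C : cong_binop S) (HC : is_commutator V C).
Context (A : algebra S) (VA : V A).
Implicit Types a b p : cong A.

(** Monotonicity is not among the defining conditions of the commutator; it holds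
    because this hull satisfies these conditions as well, and so lies below the
    commutator. *)
Definition monotone_hull : cong_binop S := fun X (a b : cong X) =>
  cong_gen (fun x y => exists u v, [/\ u <= a, v <= b & C u v x y]).

Lemma le_monotone_hull (X : algebra S) (a b u v : cong X) :
  u <= a -> v <= b -> C u v <= monotone_hull a b.
Proof.
by move=> ua vb; apply/cong_leP => x y h; apply: cong_gen_sub; exists u, v.
Qed.

Lemma monotone_hull_le (X : algebra S) (a b d : cong X) :
  (forall u v, u <= a -> v <= b -> C u v <= d) -> monotone_hull a b <= d.
Proof.
move=> h; apply: cong_gen_le => x y [u [v [ua vb]]].
exact: cong_le_rel (h _ _ ua vb).
Qed.

Lemma monotone_hullP : commutator_like V monotone_hull.
Proof.
move=> X Y f VX VY fsurj a b; split.
  apply: monotone_hull_le => u v ua vb.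
  have [h _] := HC.1 _ _ f VX VY fsurj u v.
  by apply: le_trans h _; exact: leI2.
(* by modularity, the congruences of Y below the image of c come from
   congruences of X below c itself *)
have lift c (u' : cong Y) : u' <= cong_im f (c `|` Ker f)%O ->
    exists2 u, u <= c & cong_im f (u `|` Ker f)%O = u'.
  move=> u'c; exists (c `&` cong_preim f u')%O; first exact: leIl.
  rewrite joinC Vmod ?Ker_le_preim// [(Ker f `|` c)%O]joinC.
  have -> : ((c `|` Ker f) `&` cong_preim f u')%O = cong_preim f u'.
    by apply/meet_idPr; rewrite -[X in _ <= X](imK fsurj) ?leUr// le_preim.
  exact: preimK.
apply/le_anti/andP; split.
  rewrite leUx Ker_le_preim andbT; apply: monotone_hull_le => u v ua vb.
  have [_ h] := HC.1 _ _ f VX VY fsurj u v.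
  apply: le_trans (leUl _ (Ker f)) _; rewrite h; apply: le_preim.
  by apply: le_monotone_hull; apply: cong_im_le; exact: leU2.
rewrite -[X in _ <= X](imK fsurj) ?leUr//; apply: le_preim.
apply: monotone_hull_le => u' v' /lift[u ua <-] /lift[v vb <-].
apply: (preim_le fsurj); rewrite imK ?leUr//.
have [_ <-] := HC.1 _ _ f VX VY fsurj u v.
by apply: leU2 => //; exact: le_monotone_hull.
Qed.

Lemma commutator_le a b a' b' : a <= a' -> b <= b' -> C a b <= C a' b'.
Proof.
move=> aa' bb'; apply: le_trans (HC.2 _ monotone_hullP _ VA a' b').
exact: le_monotone_hull.
Qed.

(** Over the quotient by p, the pairs a, b and a `|` p, b `|` p have the same
    images. *)
Lemma commutator_join_mod a b p :
  C (a `|` p)%O (b `|` p)%O <= (C a b `|` p)%O.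
Proof.
have fsurj := @quot_pi_surj _ _ p : surj_hom (quot_hom p).
have VQ : V (quot_algebra p) by exact: variety_H fsurj VA.
have kp : Ker (quot_hom p) = p by apply: congP => x y; exact: quot_piE.
have [_ e] := HC.1 _ _ _ VA VQ fsurj a b.
have [_ e'] := HC.1 _ _ _ VA VQ fsurj (a `|` p)%O (b `|` p)%O.
move: e e'; rewrite kp -!joinA !joinxx => -> <-.
exact: leUl.
Qed.

End CommutatorFacts.

Section Semidegenerate.
Context (S : signature) (V : variety S) (Vsemi : semidegenerate V).
Context (A : algebra S) (VA : V A).

(** Modulo the pairs (x, o(x, .., x)) the element x becomes idempotent, so the
    quotient is trivial; there are finitely many operations o. *)
Lemma semidegenerate_fingen_top : fingen (\top : cong A).
Proof.
have [x] := carrier_inhabited A.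
pose R : set (A * A) := range (fun o => (x, opr A o (fun _ => x))).
exists R; first exact/finite_image/finite_finset.
set d := cong_gen _.
apply/le_anti; rewrite lex1 andbT; apply/cong_leP => u v _.
apply/quot_piE; apply: Vsemi.
  by apply: (variety_H (f := quot_hom d)) VA; exact: quot_pi_surj.
exists (quot_pi d x) => o w wE.
have -> : w = quot_pi d \o (fun _ => x) by apply/funext.
rewrite -quot_pi_hom; apply/quot_piE/cong_sym/cong_gen_sub.
by exists o.
Qed.

End Semidegenerate.

(** * Finitely generated congruences are compact *)

Section Compactness.
Context (S : signature) (A : algebra S).
Implicit Types (a b c : cong A) (P : set (cong A)).

Definition directed P := P !=set0 /\
  forall a b, P a -> P b -> exists c, [/\ P c, a <= c & b <= c].

Lemma directed_ub P (s : seq (cong A)) : directed P ->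
  (forall a, a \in s -> P a) ->
  exists b, P b /\ forall a, a \in s -> a <= b.
Proof.
move=> [[p Pp] dP]; elim: s => [|a s IH] h; first by exists p.
have [|b [Pb bs]] := IH; first by move=> c cs; apply: h; rewrite inE cs orbT.
have Pa : P a by apply: h; rewrite mem_head.
have [c [Pc ac bc]] := dP _ _ Pa Pb; exists c; split=> // d.
by rewrite inE => /orP[/eqP -> //|/bs db]; exact: le_trans bc.
Qed.

(** A directed union of congruences is a congruence since arities are finite. *)
Lemma directed_cong_gen P : directed P -> forall x y,
  cong_gen (fun x y => exists2 a, P a & a x y) x y -> exists2 a, P a & a x y.
Proof.
move=> dP.
have [p Pp] := dP.1.
have @t : cong A.
  exists (fun x y => exists2 a, P a & a x y).
  - by move=> x; exists p => //; exact: cong_refl.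
  - by move=> x y [a Pa xy]; exists a => //; exact: cong_sym.
  - move=> x y z [a Pa xy] [b Pb yz].
    have [c [Pc ac bc]] := dP.2 _ _ Pa Pb; exists c => //.
    exact: cong_trans (cong_le_rel ac xy) (cong_le_rel bc yz).
  - move=> o x y /(_ _)/cid2-/all_sig2[a Pa axy].
    have [|b [Pb ab]] := @directed_ub P [seq a i | i <- enum 'I_(arity o)] dP.
      by move=> _ /mapP[i _ ->]; exact: Pa.
    exists b => //; apply: cong_opr => i; apply: cong_le_rel (axy i).
    by apply: ab; apply: map_f; rewrite mem_enum.
exact: (@cong_gen_min _ _ _ t).
Qed.

Lemma fingen_directed P c : directed P -> fingen c ->
  c <= cong_gen (fun x y => exists2 a, P a & a x y) ->
  exists2 a, P a & c <= a.
Proof.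
move=> dP [R finR ->] /cong_leP h.
have [p Pp] := dP.1.
have /choice[g gE] : forall q : A * A,
    exists a, P a /\ (R q -> a q.1 q.2).
  move=> [x y]; have [Rxy|] := pselect (R (x, y)); last by exists p.
  have gxy := cong_gen_sub (R := fun x y => R (x, y)) Rxy.
  by have [a Pa axy] := directed_cong_gen dP (h _ _ gxy); exists a.
have [s Rs] := (finite_seqP (T := {classic A * A}) R).1 finR.
have [|b [Pb bs]] := @directed_ub P
  (map (g : {classic A * A} -> cong A) s) dP.
  by move=> _ /mapP[q _ ->]; have [] := gE q.
exists b => //; apply: cong_gen_le => x y Rxy.
apply: (cong_le_rel (a := g (x, y))); last by have [_] := gE (x, y); apply.
by apply: bs; apply: map_f; move: Rxy; rewrite Rs.
Qed.

Lemma le_fingen_below a b :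
  (forall c, fingen c -> c <= a -> c <= b) -> a <= b.
Proof.
move=> h; apply/cong_leP => x y axy.
pose c : cong A := cong_gen (fun u v => [set (x, y)] (u, v)).
have cxy : c x y by apply: cong_gen_sub.
apply: cong_le_rel cxy; apply: h.
  by exists [set (x, y)]; first exact: finite_set1.
by apply: cong_gen_le => u v [-> ->].
Qed.

(** Every congruence is the directed join of the finitely generated congruences
    below it, so a compact element below p `|` q is below such a join for
    finitely generated parts of p and q. *)
Lemma fingen_le_join c p q : fingen c -> c <= (p `|` q)%O ->
  exists a b, [/\ fingen a, fingen b, a <= p, b <= q & c <= (a `|` b)%O].
Proof.
move=> fc cpq.
pose P := [set d : cong A | exists a b,
  [/\ fingen a, fingen b, a <= p, b <= q & d = (a `|` b)%O]].
have dP : directed P.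
  split.
    by exists (\bot `|` \bot)%O, \bot, \bot; split=> //;
      try exact: fingen_bot; exact: le0x.
  move=> _ _ [a [b [fa fb ap bq ->]]] [a' [b' [fa' fb' ap' bq' ->]]].
  exists ((a `|` a') `|` (b `|` b'))%O; split.
  - exists (a `|` a')%O, (b `|` b')%O.
    by split; rewrite ?leUx ?ap ?bq//; exact: fingenU.
  - by apply: leU2; exact: leUl.
  - by apply: leU2; exact: leUr.
have [|_ [a [b [fa fb ap bq ->]]] cd] := fingen_directed dP fc; last first.
  by exists a, b.
apply: le_trans cpq _; rewrite leUx; apply/andP.
split; apply: le_fingen_below => d fd dx; apply/cong_leP => x y dxy;
  apply: cong_gen_sub.
  exists (d `|` \bot)%O; last exact: cong_le_rel (leUl _ _) dxy.
  by exists d, \bot; split=> //; exact: fingen_bot.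
exists (\bot `|` d)%O; last exact: cong_le_rel (leUr _ _) dxy.
by exists \bot, d; split=> //; exact: fingen_bot.
Qed.

Lemma cong_Zorn (Q : set (cong A)) a : Q a ->
  (forall P, directed P -> P `<=` Q ->
    exists2 u, Q u & forall b, P b -> b <= u) ->
  exists p, [/\ Q p, a <= p & forall b, Q b -> p <= b -> b = p].
Proof.
move=> Qa Qd.
pose T := {p : cong A | Q p /\ a <= p}.
pose R (s t : T) := sval s <= sval t.
have [| | | |t tmax] := @Zorn T R.
- by move=> s; exact: lexx.
- by move=> r s t; exact: le_trans.
- by move=> [s sP] [t tP] st ts; apply: eq_exist; apply/le_anti/andP.
- move=> F Ftot.
  have [->|/set0P[s0 Fs0]] := eqVneq F set0.
    by exists (exist _ a (conj Qa (lexx a))).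
  pose P := [set sval s | s in F].
  have [| |u Qu uP] := Qd P.
  + split; first by exists (sval s0), s0.
    move=> _ _ [s Fs <-] [t Ft <-].
    have [st|ts] := Ftot s t Fs Ft.
      by exists (sval t); split=> //; exists t.
    by exists (sval s); split=> //; exists s.
  + by move=> _ [s _ <-]; exact: (svalP s).1.
  + have au : a <= u.
      apply: le_trans (svalP s0).2 _; apply: uP; exact: imageP.
    exists (exist _ u (conj Qu au)) => s Fs; apply: uP; exact: imageP.
- exists (sval t); split; [exact: (svalP t).1|exact: (svalP t).2|].
  move=> b Qb tb.
  have ab : a <= b by exact: le_trans (svalP t).2 tb.
  by have <- := tmax (exist _ b (conj Qb ab)) tb.
Qed.

End Compactness.

(** * Prime congruences and the flat topology *)

Section Spectrum.
Context (S : signature) (C : cong_binop S) (A : algebra S).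
Implicit Types (a b : cong A) (p q m n : spec C A).

Lemma spec_inj : injective (@spec_cong S C A).
Proof.
move=> [p pP] [q qP] /= e; subst q; congr Spec; exact: Prop_irrelevance.
Qed.

Lemma le_spec_anti p q : (p : cong A) <= q -> (q : cong A) <= p -> p = q.
Proof. by move=> pq qp; apply/spec_inj/le_anti/andP. Qed.

Lemma spec_top p : ~ ((\top : cong A) <= p).
Proof. by rewrite le1x; apply/negP; have [] := spec_prime p. Qed.

(** Zorn's lemma for the reverse order: the intersection of a chain of primes is
    prime since, of two members that miss a and b respectively, the smaller one
    misses both. *)
Lemma minspec_le p : exists2 m : spec C A, minspec m & (m : cong A) <= p.
Proof.
pose T := {q : spec C A | (q : cong A) <= p}.
pose R (s t : T) := (sval t : cong A) <= sval s.
have [| | | |t tmin] := @Zorn T R.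
- by move=> s; exact: lexx.
- by move=> r s t rs st; exact: le_trans st rs.
- by move=> [s sp] [t tp] st ts; apply: eq_exist; exact: le_spec_anti.
- move=> F Ftot.
  have [->|/set0P[s0 Fs0]] := eqVneq F set0.
    by exists (exist _ p (lexx (p : cong A))).
  pose i : cong A := cong_bigmeet [set (sval s : cong A) | s in F].
  have iF s : F s -> i <= sval s by move=> Fs; apply: cong_bigmeet_le; exists s.
  have iP : prime_cong C i.
    split.
      apply/eqP => itop; apply: (@spec_top (sval s0)).
      by rewrite -itop; exact: iF.
    move=> a b abi; have [|/negP nai] := boolP (a <= i); first by left.
    right; apply: le_cong_bigmeet => _ [t Ft <-].
    have [s Fs nas] : exists2 s, F s & ~ a <= sval s.
      apply: contrapT => /forall2NP h; apply: nai.
      apply: le_cong_bigmeet => _ [s Fs <-].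
      by have [|/contrapT] := h s.
    have leC u : F u -> C a b <= sval u by move=> /iF; exact: le_trans.
    have [/(le_trans _) st|/(le_trans _) ts] := Ftot _ _ Fs Ft.
      have [at_|//] := (spec_prime (sval t)).2 _ _ (leC _ Ft).
      by case: nas; exact: st.
    have [//|bs] := (spec_prime (sval s)).2 _ _ (leC _ Fs).
    exact: ts.
  have ip : i <= p by apply: le_trans (iF _ Fs0) (svalP s0).
  by exists (exist _ (Spec iP) ip) => s Fs; exact: iF.
- exists (sval t); last exact: svalP t.
  move=> q qt.
  have qp : (q : cong A) <= p by exact: le_trans qt (svalP t).
  by have <- := tmin (exist _ q qp) qt.
Qed.

Lemma mp_algebraP : mp_algebra C A <->
  forall p m n, minspec m -> minspec n ->
    (m : cong A) <= p -> (n : cong A) <= p -> m = n.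
Proof.
split=> [h p m n mm mn mp np|h p].
  have [r [_ ru]] := h p.
  by rewrite -(ru m (conj mm mp)) -(ru n (conj mn np)).
have [m mm mp] := minspec_le p; exists m; split=> // n [mn np].
exact: (h p).
Qed.

Lemma open_specV a : fingen a -> open (specV C a : set (spec C A)).
Proof.
move=> fa; exists [set a]; first by move=> _ ->.
by rewrite bigcup_set1.
Qed.

Lemma nbhs_specV p (U : set (spec C A)) :
  nbhs p U <-> exists a, [/\ fingen a, a <= p & specV C a `<=` U].
Proof.
rewrite nbhsE; split=> [[W [[D Dfin <-] [a Da ap]] WU]|[a [fa ap aU]]].
  exists a; split=> //; first exact: Dfin.
  by apply: subset_trans WU => q aq; exists a.
by exists (specV C a) => //; split; first exact: open_specV.
Qed.

Lemma open_up (U : set (spec C A)) p q :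
  open U -> U p -> (p : cong A) <= q -> U q.
Proof.
move=> oU Up pq; have /nbhs_specV[a [_ ap]] : nbhs p U by exact: open_nbhs_nbhs.
by apply; exact: le_trans pq.
Qed.

Lemma closed_down (F : set (spec C A)) p q :
  closed F -> F q -> (p : cong A) <= q -> F p.
Proof.
move=> /closed_openC oF Fq pq; apply: contrapT => nFp.
by have := open_up oF nFp pq.
Qed.

Lemma closed_le_spec p : closed [set q : spec C A | (q : cong A) <= p].
Proof.
rewrite -openC openE => q /= nqp; apply/nbhs_specV.
apply: contrapT => /forallNP h; apply: nqp; apply: le_fingen_below => a fa aq.
apply: contrapT => nap; apply: (h a); split=> // r ar rp.
by apply: nap; exact: le_trans ar rp.
Qed.

Lemma open_minspecV a : fingen a ->
  open (set_val @^-1` specV C a : set (minspec (C := C) (A := A))).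
Proof. by move=> fa; exists (specV C a); first exact: open_specV. Qed.

(** A basic neighbourhood V(a) of m = r(m) pulls back along r to a neighbourhood of
    m, which contains every p above m. Hence m <= r(p), and r(p) is minimal. *)
Lemma retraction_minspec (r : spec C A -> minspec (C := C) (A := A)) p m :
  continuous r -> (forall x, r (set_val x) = x) ->
  minspec m -> (m : cong A) <= p -> set_val (r p) = m.
Proof.
move=> rc rK mm mp; apply/esym/(set_valP (r p)).
apply: le_fingen_below => a fa am.
have oU : open (r @^-1` (set_val @^-1` specV C a)).
  by move/continuousP: rc; apply; exact: open_minspecV.
apply: (open_up oU _ mp).
by rewrite /= -[m]/(set_val (SigSub (mem_set mm))) rK.
Qed.

End Spectrum.

Section SpectrumOfQuotient.
Context (S : signature) (V : variety S) (C : cong_binop S).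
Context (HC : commutator_like V C).
Context (A B : algebra S) (f : hom A B).
Context (VA : V A) (VB : V B) (fsurj : surj_hom f).

Lemma commutator_preim (a b : cong B) :
  (C (cong_preim f a) (cong_preim f b) `|` Ker f)%O = cong_preim f (C a b).
Proof.
have [_ ->] := HC VA VB fsurj (cong_preim f a) (cong_preim f b).
have e c : (cong_preim f c `|` Ker f)%O = cong_preim f c.
  by apply/join_idPl; exact: Ker_le_preim.
by rewrite !e !preimK.
Qed.

Lemma prime_preim (q : cong B) : prime_cong C (cong_preim f q) <-> prime_cong C q.
Proof.
split=> -[ntop qP]; split.
- by apply: contra_neq ntop => ->; exact: preim_top.
- move=> a b ab.
  have [|/(preim_le fsurj)|/(preim_le fsurj)] :=
    qP (cong_preim f a) (cong_preim f b); [|by left|by right].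
  apply: le_trans (le_preim f ab); rewrite -commutator_preim; exact: leUl.
- by apply: contra_neq ntop => qtop; apply: (preim_inj fsurj);
    rewrite qtop preim_top.
- move=> a b ab.
  have [_ e] := HC VA VB fsurj a b.
  have [|aq|bq] := qP (cong_im f (a `|` Ker f)%O) (cong_im f (b `|` Ker f)%O).
  + by apply: (preim_le fsurj); rewrite -e leUx ab Ker_le_preim.
  + by left; apply: le_trans (le_preim f aq); rewrite imK ?leUl// leUr.
  + by right; apply: le_trans (le_preim f bq); rewrite imK ?leUl// leUr.
Qed.

Definition spec_preim (q : spec C B) : spec C A :=
  Spec ((prime_preim q).2 (spec_prime q)).

Lemma spec_preim_le (q q' : spec C B) :
  (spec_preim q : cong A) <= spec_preim q' <-> (q : cong B) <= q'.
Proof. by split=> [/(preim_le fsurj)|/(le_preim f)]. Qed.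

(** The primes of B correspond to the primes of A above the kernel. *)
Lemma mp_algebra_surj : (forall p : spec C A, Ker f <= p) ->
  mp_algebra C A <-> mp_algebra C B.
Proof.
move=> kp.
have surj (p : spec C A) : exists q, spec_preim q = p.
  have e : cong_preim f (cong_im f p) = p by rewrite imK.
  have pP : prime_cong C (cong_im f p).
    by apply/prime_preim; rewrite e; exact: spec_prime.
  by exists (Spec pP); apply: spec_inj.
have inj (q q' : spec C B) : spec_preim q = spec_preim q' -> q = q'.
  by move=> e; apply: le_spec_anti; apply/spec_preim_le; rewrite e.
have minE (q : spec C B) : minspec (spec_preim q) <-> minspec q.
  split=> qm r.
    by move=> /spec_preim_le/qm/inj.
  by have [r' <-] := surj r => /spec_preim_le/qm ->.
split=> /mp_algebraP mp; apply/mp_algebraP => p m n.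
  move=> /minE mm /minE nn /spec_preim_le mp' /spec_preim_le np'.
  exact: inj (mp _ _ _ mm nn mp' np').
have [[p' <-] [m' <-] [n' <-]] := And3 (surj p) (surj m) (surj n).
move=> /minE mm /minE nn /spec_preim_le mp' /spec_preim_le np'.
by rewrite (mp _ _ _ mm nn mp' np').
Qed.

End SpectrumOfQuotient.

(** * Existence and separation of primes *)

Section PrimeExistence.
Context (S : signature) (C : cong_binop S) (A : algebra S).
Implicit Types (a b : cong A) (p q m n : spec C A).
Context (topfg : fingen (\top : cong A)).
Context (C_top : C (\top : cong A) \top = \top).
Context (C_le : forall a b a' b' : cong A,
  a <= a' -> b <= b' -> C a b <= C a' b').
Context (C_join : forall a b d : cong A,
  C (a `|` d)%O (b `|` d)%O <= (C a b `|` d)%O).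
Context (C_fg : forall a b : cong A, fingen a -> fingen b -> fingen (C a b)).

Inductive commutator_words (Y : set (cong A)) : cong A -> Prop :=
| word_in a : Y a -> commutator_words Y a
| word_comm a b : commutator_words Y a -> commutator_words Y b ->
    commutator_words Y (C a b).

(** Krull's argument, for p maximal among the congruences above no commutator word
    over Y. If p misses a and b, there are words w and z below a `|` p and
    b `|` p, so [w, z] is a word below [a, b] `|` p, whence [a, b] is not below
    p. *)
Lemma prime_above_avoiding (Y : set (cong A)) a0 : Y !=set0 ->
  Y `<=` @fingen S A -> (forall a, commutator_words Y a -> ~ a <= a0) ->
  exists p, a0 <= p /\ forall y, Y y -> ~ y <= p.
Proof.
move=> [y0 Yy0] Yfg Ya0.
have wfg a : commutator_words Y a -> fingen a.
  by elim=> [b /Yfg //|b c _ fb _ fc]; exact: C_fg.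
have [P dP PQ|p [pQ a0p pmax]] := cong_Zorn
    (Q := [set p | forall a, commutator_words Y a -> ~ a <= p]) Ya0.
  exists (cong_gen (fun x y => exists2 a, P a & a x y)).
    move=> a wa /(fingen_directed dP (wfg _ wa))[b Pb].
    exact: PQ Pb a wa.
  move=> b Pb; apply/cong_leP => x y bxy; apply: cong_gen_sub; by exists b.
have above a : ~ a <= p -> exists2 w, commutator_words Y w & w <= (a `|` p)%O.
  move=> nap; apply: contrapT => /forall2NP h.
  apply: nap; rewrite -(pmax (a `|` p)%O) ?leUl ?leUr// => w ww wap.
  by have [] := h w.
have pP : prime_cong C p.
  split.
    by apply/eqP => ptop; apply: pQ (word_in Yy0) _; rewrite ptop lex1.
  move=> a b abp.
  have [|/negP/above[w ww wa]] := boolP (a <= p); first by left.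
  have [|/negP/above[z wz zb]] := boolP (b <= p); first by right.
  exfalso; apply: (pQ _ (word_comm ww wz)).
  apply: le_trans (C_le wa zb) (le_trans (C_join _ _ _) _).
  by rewrite leUx abp lexx.
by exists (Spec pP); split=> // y Yy; exact: pQ (word_in Yy).
Qed.

Lemma prime_above a0 : a0 != \top -> exists p, a0 <= p.
Proof.
move=> a0top; have [||a|p [a0p _]] := @prime_above_avoiding [set \top] a0.
- by exists \top.
- by move=> _ ->.
- move=> wa; suff -> : a = \top by rewrite le1x; exact/negP.
  by elim: wa => [b -> //|b c _ -> _ ->].
- by exists p.
Qed.

(** A commutator word involves finitely many elements of Y, and a prime that
    avoids these avoids the word; so no word is trivial, and some prime avoids all
    of Y. *)
Lemma prime_avoiding (Y : set (cong A)) : Y `<=` @fingen S A ->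
  (forall s : seq (cong A), (forall y, y \in s -> Y y) ->
    exists p, forall y, y \in s -> ~ y <= p) ->
  exists p, forall y, Y y -> ~ y <= p.
Proof.
move=> Yfg Yfin.
have words a : commutator_words (Y `|` [set \top]) a ->
    exists2 s : seq (cong A), (forall y, y \in s -> Y y) &
      forall p, (forall y, y \in s -> ~ y <= p) -> ~ a <= p.
  elim=> [b [Yb|->]|b c _ [s sY sb] _ [t tY tc]].
  - exists [:: b] => [y|p]; first by rewrite inE => /eqP ->.
    by apply; rewrite mem_head.
  - by exists [::] => // p _; exact: spec_top.
  - exists (s ++ t) => [y|p h].
      by rewrite mem_cat => /orP[/sY|/tY].
    move=> /(spec_prime p).2[|].
      by apply: sb => y ys; apply: h; rewrite mem_cat ys.
    by apply: tc => y yt; apply: h; rewrite mem_cat yt orbT.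
have [||a /words[s sY sa] abot|p [_ pY]] :=
  @prime_above_avoiding (Y `|` [set \top]) \bot.
- by exists \top; right.
- by move=> y [/Yfg //|->].
- have [p ps] := Yfin s sY.
  by apply: sa ps _; apply: le_trans abot (le0x _).
- by exists p => y Yy; apply: pY; left.
Qed.

(** An ultrafilter converges to any prime that avoids all finitely generated a for
    which V(a) is not in the ultrafilter. *)
Lemma flat_compact : compact [set: spec C A].
Proof.
rewrite compact_ultra => F FU _.
pose Y := [set a : cong A | fingen a /\ ~ F (specV C a)].
have [|s sY|p pY] := @prime_avoiding Y.
- by move=> a [].
- suff : F [set p | forall y, y \in s -> ~ y <= p] by move=> /filter_ex.
  elim: s sY => [_|a s IH sY].
    by apply: filterS filterT => p _ y; rewrite in_nil.
  have [_ nFa] : Y a by apply: sY; rewrite mem_head.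
  have Fs : F [set p | forall y, y \in s -> ~ y <= p].
    by apply: IH => y ys; apply: sY; rewrite inE ys orbT.
  have [//|Fa] := in_ultra_setVsetC (specV C a) FU.
  apply: filterS (filterI Fa Fs) => p [nap ps] y.
  by rewrite inE => /orP[/eqP ->|/ps].
- exists p; split=> // U /nbhs_specV[a [fa ap aU]].
  apply: filterS aU _; apply: contrapT => nFa.
  by apply: (pY a).
Qed.

Lemma comaximal_or_prime (a b : cong A) :
  (a `|` b)%O = \top \/ exists p, a <= p /\ b <= p.
Proof.
have [|/prime_above[p]] := eqVneq (a `|` b)%O \top; first by left.
by rewrite leUx => /andP[ap bp]; right; exists p.
Qed.

Lemma mp_algebra_comaximal : mp_algebra C A <->
  forall p q, minspec p -> minspec q -> p <> q ->
    ((p : cong A) `|` (q : cong A))%O = \top.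
Proof.
split=> [/mp_algebraP mp p q pm qm npq|h].
  have [//|[r [pr qr]]] := comaximal_or_prime p q.
  by case: npq; exact: mp pr qr.
apply/mp_algebraP => p m n mm mn mp np; apply: contrapT => mn'.
by apply: (@spec_top _ _ _ p); rewrite -(h m n) // leUx mp np.
Qed.

Lemma comaximal_fingen (a b : cong A) : (a `|` b)%O = \top ->
  exists c d, [/\ fingen c, fingen d, c <= a, d <= b & (c `|` d)%O = \top].
Proof.
move=> ab; have [|c [d [fc fd ca db cd]]] := @fingen_le_join _ _ _ a b topfg.
  by rewrite ab.
by exists c, d; split=> //; apply/eqP; rewrite -le1x.
Qed.

Lemma mp_retraction : mp_algebra C A -> has_minspec_retraction C A.
Proof.
move=> /mp_algebraP mp.
have /choice[g g_le] : forall p, exists m : minspec (C := C) (A := A),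
    (set_val m : cong A) <= p.
  move=> p; have [m mm mp'] := minspec_le p.
  by exists (SigSub (mem_set mm)).
have gE p m : minspec m -> (m : cong A) <= p -> set_val (g p) = m.
  by move=> mm mp'; apply: mp (g_le p) mp' => //; exact: set_valP.
exists g; last first.
  by move=> m; apply: val_inj; exact: gE (set_valP m) (lexx _).
apply: continuous_comp_initial => p U /nbhs_specV[a [fa agp aU]].
suff [x [fx xp xV]] : exists x, [/\ fingen x, x <= p &
    forall q, x <= q -> a <= set_val (g q)].
  by apply/nbhs_specV; exists x; split=> // q xq; apply: aU; exact: xV.
(* A prime that avoids Y would not be above a, so its minimal prime would differ
   from g p; it would be comaximal with p, hence above some y in Y. *)
pose Y := [set y : cong A | fingen y /\
  (y = a \/ exists x, [/\ fingen x, x <= p & (x `|` y)%O = \top])].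
have [s sY sV] : exists2 s : seq (cong A), (forall y, y \in s -> Y y) &
    forall q, exists2 y, y \in s & y <= q.
  apply: contrapT => /forall2NP h.
  have [|s sY|n nY] := @prime_avoiding Y; first by move=> y [].
    have [//|/existsNP[q hq]] := h s; exists q => y ys yq.
    by apply: hq; exists y.
  have nan : ~ a <= n by apply: nY; split=> //; left.
  have [pn|[r [pr nr]]] := comaximal_or_prime p n.
    have [c [d [fc fd cp dn cd]]] := comaximal_fingen pn.
    by apply: (nY d) dn; split=> //; right; exists c.
  apply: nan; apply: le_trans agp _ => /=.
  have -> : set_val (g p) = set_val (g n).
    apply: (mp r); try exact: set_valP.
      exact: le_trans (g_le p) pr.
    exact: le_trans (g_le n) nr.
  exact: g_le.
(* since s is finite, one x serves all its members *)
have [x [fx xp xs]] : exists x, [/\ fingen x, x <= p &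
    forall y, y \in s -> y = a \/ (x `|` y)%O = \top].
  elim: s sY {sV} => [_|y s IH sY].
    by exists \bot; split=> //; exact: fingen_bot.
  have [|x [fx xp xs]] := IH.
    by move=> z zs; apply: sY; rewrite inE zs orbT.
  have [_ [ya|[z [fz zp zy]]]] : Y y by apply: sY; rewrite mem_head.
    by exists x; split=> // w; rewrite inE => /orP[/eqP ->|/xs]; [left|].
  exists (x `|` z)%O; split; [exact: fingenU|by rewrite leUx xp|].
  move=> w; rewrite inE => /orP[/eqP ->|/xs[->|xw]]; [right|by left|right].
    by rewrite -joinA zy joinx1.
  by rewrite joinAC xw join1x.
exists x; split=> // q xq; have [y ys yg] := sV (set_val (g q)).
have [ya|xy] := xs y ys; first by rewrite -ya.
case: (@spec_top _ _ _ q); rewrite -xy leUx xq.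
exact: le_trans yg (g_le q).
Qed.

Lemma retraction_mp : has_minspec_retraction C A -> mp_algebra C A.
Proof.
move=> [r rc rK]; apply/mp_algebraP => p m n mm mn mp np.
by rewrite -(retraction_minspec rc rK mm mp) (retraction_minspec rc rK mn np).
Qed.

Lemma minspec_hausdorff : mp_algebra C A ->
  hausdorff_space (minspec (C := C) (A := A)).
Proof.
move=> /mp_algebra_comaximal mp; rewrite open_hausdorff => m n /eqP mn.
have [|c [d [fc fd cm dn cd]]] :=
    @comaximal_fingen (set_val m : spec C A) (set_val n : spec C A).
  by apply: mp; [exact: set_valP|exact: set_valP|move=> /val_inj].
exists (set_val @^-1` specV C c, set_val @^-1` specV C d).
  by rewrite !inE.
split; [exact: open_minspecV|exact: open_minspecV|].
apply/eqP/seteqP; split=> // p [cp dp].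
by case: (@spec_top _ _ _ (set_val p)); rewrite -cd leUx; apply/andP.
Qed.

(** The minimal spectrum is compact Hausdorff, hence normal, and normality pulls
    back along the retraction r since closed sets are closed downwards, open sets
    upwards, and r(p) <= p. *)
Lemma mp_normal : mp_algebra C A -> normal_space (spec C A).
Proof.
move=> mp; have [r rc rK] := mp_retraction mp.
have r_le p : (set_val (r p) : cong A) <= p.
  have [m mm mp'] := minspec_le p.
  by rewrite (retraction_minspec rc rK mm mp').
have vc : continuous (set_val : minspec (C := C) (A := A) -> spec C A).
  exact: initial_continuous.
have Mcompact : compact [set: minspec (C := C) (A := A)].
  have -> : [set: minspec (C := C) (A := A)] = r @` setT.
    by apply/seteqP; split=> // m _; exists (set_val m).
  apply: continuous_compact flat_compact.
  exact: continuous_subspaceT.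
move=> F Fcl U /set_nbhsP[W [oW FW WU]].
have [||N FN NW] := compact_normal (minspec_hausdorff mp) Mcompact
    (A := set_val @^-1` F) _ (t := set_val @^-1` W).
- by move/continuous_closedP: vc; exact.
- move=> m Fm; apply: vc; apply: open_nbhs_nbhs; split=> //; exact: FW.
exists (r @^-1` N).
  by move=> p Fp; apply: rc; apply: FN; exact: closed_down Fcl Fp (r_le p).
move=> p pN; apply: WU; apply: open_up oW _ (r_le p).
apply: NW => N' /rc /pN[q [Nq N'q]]; by exists (r q).
Qed.

(** The closure of a minimal prime m is its singleton. Two distinct minimal primes
    below p have no disjoint neighbourhoods, as these would all contain p. *)
Lemma normal_mp : normal_space (spec C A) -> mp_algebra C A.
Proof.
move=> norm; apply/mp_algebraP => p m n mm mn mp np; apply: contrapT => mn'.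
have oW : open (~` [set q : spec C A | (q : cong A) <= n])%classic.
  by rewrite openC; exact: closed_le_spec.
have cl : closed [set q : spec C A | (q : cong A) <= m].
  exact: closed_le_spec.
have [|N mN NW] := norm _ cl (~` [set q : spec C A | (q : cong A) <= n])%classic.
  move=> q /mm -> ; apply: open_nbhs_nbhs; split=> //= mn2; apply: mn'.
  exact: mn.
have /nbhs_specV[a [fa am aN]] := mN m (lexx _).
apply: (NW n) (lexx _) => U /nbhs_specV[b [fb bn bU]].
exists p; split; first by apply: aN; exact: le_trans am mp.
by apply: bU; exact: le_trans bn np.
Qed.

(** For m minimal, V(m) is the preimage of the point m under the retraction, and
    points of the Hausdorff minimal spectrum are closed. *)
Lemma retraction_closed : has_minspec_retraction C A ->
  forall m, minspec m -> closed (specV C m).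
Proof.
move=> hr m mm; have mp := retraction_mp hr; have [r rc rK] := hr.
have -> : specV C m = r @^-1` [set r m].
  apply/seteqP; split=> p.
    move=> mp'; apply: val_inj.
    apply: etrans (retraction_minspec rc rK mm mp') (esym _).
    exact: retraction_minspec.
  have [n mn np] := minspec_le p.
  move=> /= /(congr1 set_val).
  rewrite (retraction_minspec rc rK mm (lexx _)).
  by rewrite (retraction_minspec rc rK mn np) => <-.
move/continuous_closedP: rc; apply.
exact/accessible_closed_set1/hausdorff_accessible/minspec_hausdorff.
Qed.

(** If V(m) is closed it is closed downwards, so it contains every minimal prime
    below a prime above m. *)
Lemma closed_mp : (forall m, minspec m -> closed (specV C m)) ->
  mp_algebra C A.
Proof.
move=> cl; apply/mp_algebraP => p m n mm mn mp np.
by apply: mn; exact: closed_down (cl m mm) mp np.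
Qed.

End PrimeExistence.

Theorem theorem9p14 (S : signature) (V : variety S)
    (Vmod : congruence_modular V) (Vsemi : semidegenerate V)
    (C : cong_binop S) (HC : is_commutator V C)
    (A : algebra S) (VA : V A)
    (KA : forall a b : cong A, fingen a -> fingen b -> fingen (C A a b)) :
  [<-> mp_algebra C A;
       forall p q : spec C A, minspec p -> minspec q -> p <> q ->
         ((p : cong A) `|` (q : cong A))%O = \top;
       mp_algebra C (quot_algebra (rho C (\bot : cong A)));
       has_minspec_retraction C A;
       normal_space (spec C A);
       forall p : spec C A, minspec p -> closed (specV C p)].
Proof.
have topfg := semidegenerate_fingen_top Vsemi VA.
have C_top : C A \top \top = \top.
  apply/le_anti; rewrite lex1 /=.
  rewrite -[X in X <= _](semidegenerate_term_commutator Vsemi VA).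
  exact: HC.2 (term_commutatorP Vmod) _ VA _ _.
have C_le := commutator_le Vmod HC VA.
have C_join := commutator_join_mod HC VA.
have mp2 := mp_algebra_comaximal topfg C_top C_le C_join KA.
have mp3 : mp_algebra C A <-> mp_algebra C (quot_algebra (rho C (\bot : cong A))).
  have fsurj := @quot_pi_surj _ _ (rho C (\bot : cong A)).
  have VQ : V (quot_algebra (rho C (\bot : cong A))).
    exact: (variety_H (f := quot_hom _)) fsurj VA.
  apply: (@mp_algebra_surj _ _ _ HC.1 _ _ (quot_hom _) VA VQ fsurj).
  move=> p; apply/cong_leP => x y /quot_piE h; apply: h; split.
    exact: spec_prime.
  exact: le0x.
tfae.
- exact/mp2.1.
- by move=> /mp2.2/mp3.1.
- move=> /mp3.2; exact: mp_retraction topfg C_top C_le C_join KA.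
- move=> /retraction_mp; exact: mp_normal topfg C_top C_le C_join KA.
- move=> /normal_mp/(mp_retraction topfg C_top C_le C_join KA).
  exact: retraction_closed topfg C_top C_le C_join KA.
- exact: closed_mp.
Qed.
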